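(* Let $p$ be a prime, $b\ge1$ an integer, $R=\mathbb{Z}_p[x]/\langle x^{2b}\rangle$, and $\varGamma(R)$ its zero-divisor graph, with vertex partition $V(\varGamma(R))=\bigcup_{i=1}^{2b-1}V_i$, where $V_i=\{\sum_{k=i}^{2b-1}a_kx^k: a_i\neq0\}$ and $n_i=|V_i|=(p-1)p^{2b-1-i}$. Put \[d_i=\begin{cases}p^i-1,&1\le i\le b-1,\\ p^i-2,& b\le i\le 2b-1,\end{cases}\] (every vertex of $V_i$ has degree $d_i$). Let $Q^*=(Q^*_{ij})_{1\le i,j\le 2b-1}$ be given by $Q^*_{ii}=0$ for $1\le i\le b-1$, $Q^*_{ii}=n_i-1$ for $b\le i\le 2b-1$, and for $i\ne j$: $Q^*_{ij}=n_j$ if $i+j\ge 2b$ and $Q^*_{ij}=0$ if $i+j<2b$. Let $D^*=\mathrm{diag}(d_1,\dots,d_{2b-1})$ and $B=\alpha D^*+(1-\alpha)Q^*$, where $0\le\alpha\le1$. Then the spectrum (as a multiset) of $A_\alpha(\varGamma(R))$ consists of: for each $i=1,\dots,2b-1$, the eigenvalue \[\lambda_i=\begin{cases}\alpha(p^i-1),&1\le i\le b-1,\\ \alpha(p^i-1)-1,& b\le i\le 2b-1,\end{cases}\] with multiplicity $n_i-1=(p-1)p^{2b-1-i}-1$; together with the $2b-1$ eigenvalues $\theta_1,\dots,\theta_{2b-1}$ of the $(2b-1)\times(2b-1)$ matrix $B$.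
   Context: The zero-divisor graph $\varGamma(R)$ of a commutative ring $R$ has vertex set the nonzero zero-divisors of $R$, distinct $x,y$ adjacent iff $xy=0$. For a graph $G$ with adjacency matrix $A(G)$ and diagonal degree matrix $D(G)$, and $0\le\alpha\le1$, $A_\alpha(G)=\alpha D(G)+(1-\alpha)A(G)$. $Q^*$ is the quotient matrix of $A(\varGamma(R))$ with respect to the partition $\{V_i\}$ (its $(i,j)$ entry is the number of neighbours in $V_j$ of any vertex of $V_i$). *)

(* Defs.v *)
From HB Require Import structures.
From mathcomp Require Import all_boot all_order all_algebra.
From mathcomp Require Import qfpoly complex.

Set Implicit Arguments.
Unset Strict Implicit.
Unset Printing Implicit Defensive.

Import Order.TTheory GRing.Theory Num.Theory.

Local Open Scope ring_scope.

(* A finite simple graph is given by a vertex set [V] in a finType [T] and an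
   adjacency relation [e] on [T], of which only the restriction to [V] matters.
   Matrices attached to it are indexed through [enum_val : 'I_#|V| -> T]. *)
Section Graphs.
Variables (T : finType) (V : {set T}) (e : rel T).

Definition neighbours (x : T) : {set T} := [set y in V | e x y].

Definition degree (x : T) : nat := #|neighbours x|.

Definition adjacency_mx (K : pzRingType) : 'M[K]_#|V| :=
  \matrix_(i, j) (e (enum_val i) (enum_val j))%:R.

Definition degree_mx (K : pzRingType) : 'M[K]_#|V| :=
  diag_mx (\row_i (degree (enum_val i))%:R).

Definition Aalpha_mx (K : pzRingType) (alpha : K) : 'M[K]_#|V| :=
  alpha *: degree_mx K + (1 - alpha) *: adjacency_mx K.

End Graphs.

Section ZeroDivisorGraph.
Variable S : finComNzRingType.

Definition zero_divisor (x : S) : bool := [exists y : S, (y != 0) && (x * y == 0)].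

Definition zdg_vertices : {set S} := [set x | (x != 0) && zero_divisor x].

Definition zdg_adj : rel S := fun x y => (x != y) && (x * y == 0).

End ZeroDivisorGraph.

(* The eigenvalues in the complex numbers [R[i]] of a real matrix, repeated
   according to their algebraic multiplicity.  The order of the list is
   unspecified, so it is to be used up to [perm_eq]. *)
Definition spectrum (R : rcfType) (n : nat) (M : 'M[R]_n) : seq R[i] :=
  sval (closed_field_poly_normal (char_poly (map_mx (real_complex R) M))).

Lemma spectrumP (R : rcfType) (n : nat) (M : 'M[R]_n) :
  char_poly (map_mx (real_complex R) M) =
    \prod_(z <- spectrum M) ('X - z%:P).
Proof.
rewrite /spectrum; case: closed_field_poly_normal => r /= ->.
rewrite [X in X *: _ = _](_ : _ = 1) ?scale1r //.
by apply/monicP/char_poly_monic.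
Qed.

Lemma size_spectrum (R : rcfType) (n : nat) (M : 'M[R]_n) :
  size (spectrum M) = n.
Proof.
apply/eqP; rewrite -eqSS -(size_prod_XsubC _ id) -spectrumP.
by rewrite size_char_poly.
Qed.

Notation truncated_poly_ring p b := {poly %/ ('X^(2 * b) : {poly 'F_p})}.

Definition Vpart (p b i : nat) : {set truncated_poly_ring p b} :=
  [set \sum_(i <= k < 2 * b)
         (a`_k *: 'qX ^+ k : truncated_poly_ring p b)
    | a : (2 * b).-tuple 'F_p & a`_i != 0].

Definition npart (p b i : nat) : nat := ((p - 1) * p ^ (2 * b - 1 - i))%N.

Definition dpart (p b i : nat) : nat :=
  if (i < b)%N then (p ^ i - 1)%N else (p ^ i - 2)%N.

Definition Qentry (p b i j : nat) : nat :=
  if i == j then (if (i < b)%N then 0%N else (npart p b i - 1)%N)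
  else if (2 * b <= i + j)%N then npart p b j else 0%N.

(* Row and column [i : 'I_(2 * b - 1)] correspond to the index [i.+1] in
   1, ..., 2 * b - 1. *)
Definition Qstar (K : pzRingType) (p b : nat) : 'M[K]_(2 * b - 1) :=
  \matrix_(i, j) (Qentry p b i.+1 j.+1)%:R.

Definition Dstar (K : pzRingType) (p b : nat) : 'M[K]_(2 * b - 1) :=
  diag_mx (\row_i (dpart p b i.+1)%:R).

Definition Bmx (K : pzRingType) (p b : nat) (alpha : K) : 'M[K]_(2 * b - 1) :=
  alpha *: Dstar K p b + (1 - alpha) *: Qstar K p b.

Definition lambda (K : pzRingType) (p b : nat) (alpha : K) (i : nat) : K :=
  if (i < b)%N then alpha * (p%:R ^+ i - 1) else alpha * (p%:R ^+ i - 1) - 1.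

(* Main.v *)
(* On the vertices of [V_i] the matrix A_alpha is [lambda_i] times the identity
   plus a matrix that is constant on each block [V_i x V_j], with value
   [q_ij = (1 - alpha) * [i + j >= 2b]]: membership in [V_i] means X-adic order
   [i], and [xy = 0] iff the orders of [x] and [y] add up to at least [2b].  So
   A_alpha = Lambda + S q S^T for the indicator matrix [S] of the partition, and
   Sylvester's determinant identity gives
   char_poly A_alpha = \prod_i (X - lambda_i)^(n_i - 1) * char_poly B. *)

Require Import Defs.
From mathcomp Require Import all_boot all_order all_algebra.
From mathcomp Require Import qfpoly complex ring.

Import Order.TTheory GRing.Theory Num.Theory.
Local Open Scope ring_scope.
Local Open Scope complex_scope.

(** * Determinants and characteristic polynomials of block-constant matrices *)

Lemma det_diag_mx_fibre (K : comNzRingType) (n m : nat) (c : 'I_n -> 'I_m)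
    (d : 'I_m -> K) :
  \det (diag_mx (\row_i d (c i))) = \prod_k d k ^+ #|[set i | c i == k]|.
Proof.
rewrite det_diag; under eq_bigr do rewrite mxE.
rewrite (partition_big c predT) //=; apply: eq_bigr => k _.
rewrite (eq_bigr (fun=> d k)) => [|i /eqP -> //].
rewrite prodr_const -[in RHS]sum1_card -sum1_card.
by under [in RHS]eq_bigl do rewrite inE.
Qed.

(* Sylvester's identity without inverting [D] and [E]: evaluate the determinant
   of [D S; T 1] times a triangular block matrix in two ways. *)
Lemma det_sub_mul_intertwine (K : comNzRingType) (n m : nat)
    (D : 'M[K]_n) (S : 'M[K]_(n, m)) (T : 'M[K]_(m, n)) (E : 'M[K]_m) :
  D *m S = S *m E ->
  \det (D - S *m T) * \det E = \det D * \det (E - T *m S).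
Proof.
move=> DS.
have lower : block_mx D S T 1%:M *m block_mx 1%:M 0 (- T) 1%:M
    = block_mx (D - S *m T) S 0 1%:M.
  by rewrite mulmx_block !mulmx0 !mulmx1 !mul1mx mulmxN subrr !add0r.
have upper : block_mx D S T 1%:M *m block_mx 1%:M (- S) 0 E
    = block_mx D 0 T (E - T *m S).
  by rewrite mulmx_block !mulmx0 !mulmx1 !mul1mx !mulmxN DS addNr !addr0 addrC.
have := congr1 determinant lower; rewrite det_mulmx det_lblock det_ublock.
rewrite !det1 !mulr1 => <-.
have := congr1 determinant upper.
by rewrite det_mulmx det_ublock det_lblock det1 mul1r.
Qed.

(** Apply the determinant identity over [{poly K}] with [S] the indicator matrix of the classes of
    [c] and [D], [E] diagonal with entries ['X - l k]. Then [D - S *m T] and [E - T *m S] are the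
    two characteristic matrices, and [\det D] contains each factor ['X - l k] exactly [sz k]
    times. *)
Lemma char_poly_equitable (K : idomainType) (n m : nat) (c : 'I_n -> 'I_m)
    (l : 'I_m -> K) (q : 'I_m -> 'I_m -> K) (sz : 'I_m -> nat) :
  (forall k, #|[set i | c i == k]| = sz k) -> (forall k, (0 < sz k)%N) ->
  char_poly (\matrix_(i, j) (l (c i) *+ (i == j) + q (c i) (c j))) =
  \prod_k ('X - (l k)%:P) ^+ (sz k - 1) *
    char_poly (\matrix_(k, k') (l k *+ (k == k') + q k k' * (sz k')%:R)).
Proof.
move=> card_fibre sz_gt0.
set M := (X in char_poly X = _); set B := (X in _ * char_poly X).
pose X_l k : {poly K} := 'X - (l k)%:P.
pose D := diag_mx (\row_i X_l (c i)); pose E := diag_mx (\row_k X_l k).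
pose S : 'M[{poly K}]_(n, m) := \matrix_(i, k) (c i == k)%:R.
pose T : 'M[{poly K}]_(m, n) := \matrix_(k, j) (q k (c j))%:P.
have DS : D *m S = S *m E.
  apply/matrixP => i k; rewrite mul_diag_mx mul_mx_diag !mxE.
  by case: eqP => [->|_]; rewrite ?mulr1 ?mul1r ?mulr0 ?mul0r.
have charM : char_poly_mx M = D - S *m T.
  apply/matrixP => i j; rewrite !mxE (bigD1 (c i)) //= big1 => [|k /negPf ck].
    rewrite !mxE eqxx mul1r addr0 polyCD opprD addrA; congr (_ - _).
    by case: (i =P j) => [->|_]; rewrite /X_l ?mulr1n ?mulr0n ?subrr.
  by rewrite !mxE eq_sym ck mul0r.
have charB : char_poly_mx B = E - T *m S.
  apply/matrixP => k k'; rewrite !mxE.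
  rewrite [X in _ = _ - X](_ : _ = \sum_(i in [set i | c i == k']) (q k k')%:P).
    rewrite sumr_const card_fibre mulr_natr polyCD opprD addrA !polyCMn.
    congr (_ - _).
    by rewrite -mulrnBl.
  rewrite [RHS]big_mkcond; apply: eq_bigr => i _; rewrite !mxE inE.
  by case: eqP => [->|_]; rewrite ?mulr1 ?mulr0.
have detE : \det E = \prod_k X_l k.
  by rewrite det_diag; apply: eq_bigr => k _; rewrite mxE.
have E_neq0 : \det E != 0.
  by rewrite detE; apply/prodf_neq0 => k _; rewrite polyXsubC_eq0.
(* Cancelling [\det E] removes one factor per class, whence the exponents [sz k - 1]. *)
apply: (mulIf E_neq0); rewrite /char_poly charM charB.
rewrite det_sub_mul_intertwine // det_diag_mx_fibre mulrAC; congr (_ * _).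
rewrite detE -big_split; apply: eq_bigr => k _ /=.
by rewrite card_fibre -exprSr subn1 prednK.
Qed.

(** * The X-adic order of a polynomial, as the multiplicity of the root 0 *)

Lemma dvdp_XnP (F : fieldType) (q : {poly F}) (n : nat) :
  reflect (forall k, (k < n)%N -> q`_k = 0) ('X^n %| q).
Proof.
apply: (iffP idP) => [/dvdpP[r ->] k kn|q_lo]; first by rewrite coefMXn kn.
rewrite -(poly_take_drop n q) dvdp_addr ?dvdp_mull //.
suff -> : take_poly n q = 0 by rewrite dvdp0.
by apply/polyP => k; rewrite coef_take_poly coef0; case: ifP => // /q_lo.
Qed.

Lemma mup0_geq (F : fieldType) (q : {poly F}) (n : nat) :
  q != 0 -> (n <= mup 0 q)%N = ('X^n %| q).
Proof. by move=> q_neq0; rewrite mup_geq // subr0. Qed.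

Lemma mup0_lt_size (F : fieldType) (q : {poly F}) :
  q != 0 -> (mup 0 q < size q)%N.
Proof.
move=> q_neq0; rewrite -(size_polyXn F (mup 0 q)); apply: dvdp_leq => //.
by rewrite -mup0_geq.
Qed.

(** * Orders in the truncated polynomial ring and the sizes of the classes *)

Section TruncatedPolynomials.

Variables p b : nat.
Hypotheses (p_prime : prime p) (b_gt0 : (0 < b)%N).

Local Notation A := (truncated_poly_ring p b).
Implicit Types (x y : A) (i j k : nat).

(** The quotient is taken modulo [mk_monic] of the given polynomial, which falls back to ['X] on
    constants; [b > 0] excludes this case. *)
Lemma truncated_modulusE : mk_monic 'X^(2 * b) = 'X^(2 * b) :> {poly 'F_p}.
Proof. by rewrite mk_monic_Xn prednK // muln_gt0. Qed.

Lemma size_truncated x : (size (x : {poly 'F_p}) <= 2 * b)%N.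
Proof.
apply: leq_trans (size_npoly x) _.
by rewrite truncated_modulusE size_polyXn.
Qed.

Lemma truncated_eq0 x : (x == 0) = ((x : {poly 'F_p}) == 0).
Proof. by []. Qed.

Lemma truncated_mul_eq0 x y :
  (x * y == 0) = ('X^(2 * b) %| (x : {poly 'F_p}) * y).
Proof.
rewrite truncated_eq0 poly_of_qpolyM; move: ((x : {poly 'F_p}) * y) => q.
by rewrite truncated_modulusE Pdiv.Idomain.dvdpE.
Qed.

Lemma truncated_Xexp k : (k < 2 * b)%N -> ('qX ^+ k : A) = 'X^k :> {poly 'F_p}.
Proof.
move=> kb; rewrite -rmorphXn in_qpoly_small //.
by rewrite truncated_modulusE !size_polyXn.
Qed.

(** The value at 0 is a mere convention, so statements about orders assume [x != 0]. *)
Definition ord_truncated x : nat := mup 0 (x : {poly 'F_p}).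

Lemma ord_truncated_lt x : x != 0 -> (ord_truncated x < 2 * b)%N.
Proof.
move=> x0; apply: leq_trans (size_truncated x).
exact: (@mup0_lt_size 'F_p).
Qed.

(** Orders of representatives add, since multiplicities of roots add over a field. *)
Lemma truncated_mul_eq0_ord x y : x != 0 -> y != 0 ->
  (x * y == 0) = (2 * b <= ord_truncated x + ord_truncated y)%N.
Proof.
by move=> x0 y0; rewrite truncated_mul_eq0 -mup0_geq ?mulf_neq0 ?mupM.
Qed.

Lemma coef_Vpart_sum (a : nat -> 'F_p) i k :
  (\sum_(i <= j < 2 * b) (a j *: 'qX ^+ j : A) : A)`_k =
  if (i <= k < 2 * b)%N then a k else 0.
Proof.
rewrite poly_of_qpoly_sum coef_sum.
rewrite big_nat_cond (eq_bigr (fun j => if j == k then a k else 0)); last first.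
  move=> j /andP[/andP[_ jb] _]; rewrite poly_of_qpolyZ truncated_Xexp //.
  by rewrite coefZ coefXn eq_sym; case: eqP => [->|_]; rewrite ?mulr1 ?mulr0.
by rewrite -big_nat_cond -big_mkcond big_nat1_eq.
Qed.

Lemma mem_Vpart i x : (i < 2 * b)%N ->
  (x \in Vpart p b i) = (x != 0) && (ord_truncated x == i).
Proof.
move=> ib; apply/imsetP/andP => [[a ai_neq0 ->]|[x0 /eqP ord_x]].
  rewrite inE in ai_neq0.
  set y := \sum_(_ <= _ < _) _.
  have yE k : (y : {poly 'F_p})`_k = if (i <= k < 2 * b)%N then a`_k else 0.
    exact: (coef_Vpart_sum (fun k => a`_k)).
  have y0 : (y : {poly 'F_p}) != 0.
    apply: contraNneq ai_neq0 => /(congr1 (fun q : {poly _} => q`_i)).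
    by rewrite yE leqnn ib coef0 /= => ->.
  split=> //; rewrite eqn_leq /ord_truncated leqNgt !mup0_geq //.
  apply/andP; split; last first.
    by apply/dvdp_XnP => k ki; rewrite yE leqNgt ki.
  apply: contraNN ai_neq0 => /dvdp_XnP/(_ i (leqnn _)).
  by rewrite yE leqnn ib /= => ->.
have /dvdp_XnP x_lo : 'X^i %| (x : {poly 'F_p}).
  by rewrite -mup0_geq // -ord_x.
(* All coefficients of [x] serve as witness; those below [i] vanish anyway. *)
pose a := [tuple (x : {poly 'F_p})`_k | k < 2 * b].
have aE k : (k < 2 * b)%N -> a`_k = (x : {poly 'F_p})`_k.
  by move=> kb; rewrite -(tnth_nth _ a (Ordinal kb)) tnth_mktuple.
exists a.
  rewrite inE aE //; apply/eqP => xi0.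
  suff: (i.+1 <= ord_truncated x)%N by rewrite ord_x ltnn.
  rewrite mup0_geq //; apply/dvdp_XnP => k.
  by rewrite ltnS leq_eqVlt => /predU1P[->|/x_lo].
apply: val_inj; apply/polyP => k /=; rewrite (coef_Vpart_sum (fun k => a`_k)).
case: ifP => [/andP[_ kb]|]; first by rewrite aE.
move/negbT; rewrite negb_and -ltnNge -leqNgt => /orP[/x_lo //|kb].
by rewrite nth_default // (leq_trans (size_truncated x)).
Qed.

(** Multiplication by ['X^k] is a bijection from the polynomials of size at most [2 * b - k] onto
    this ideal, as no reduction modulo ['X^(2 * b)] occurs. *)
Lemma card_dvdp_Xn k : (k <= 2 * b)%N ->
  #|[set x : A | 'X^k %| (x : {poly 'F_p})]| = (p ^ (2 * b - k))%N.
Proof.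
move=> kb; pose f (q : {poly_(2 * b - k) 'F_p}) : A :=
  in_qpoly _ ((q : {poly 'F_p}) * 'X^k).
have fE q : f q = (q : {poly 'F_p}) * 'X^k :> {poly 'F_p}.
  rewrite in_qpoly_small // truncated_modulusE size_polyXn ltnS.
  apply: leq_trans (size_polyMleq _ _) _; rewrite size_polyXn addnS /=.
  by rewrite addnC -leq_subRL // size_npoly.
have f_dvd q : 'X^k %| (f q : {poly 'F_p}) by rewrite fE dvdp_mull.
have polyn_inj x y : (x : {poly 'F_p}) = y -> x = y by move/val_inj.
have f_inj : injective f.
  move=> q r /(congr1 (fun x : A => x : {poly 'F_p})); rewrite !fE.
  by move/(mulIf _) => qr; apply/val_inj/qr; rewrite -size_poly_eq0 size_polyXn.
have -> : [set x : A | 'X^k %| (x : {poly 'F_p})] = f @: setT.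
  apply/setP => x; rewrite inE; apply/idP/imsetP => [/dvdpP[q xq]|[q _ ->]].
    have q_size : (size q <= 2 * b - k)%N.
      rewrite leq_subRL //.
      have := size_truncated x; rewrite xq; have [->|q0] := eqVneq q 0.
        by rewrite size_poly0 addn0.
      by rewrite size_mulXn.
    exists (NPoly (q_size : q \is a poly_of_size _)); rewrite ?inE //.
    by apply: polyn_inj; rewrite fE.
  exact: f_dvd.
by rewrite card_imset // cardsT card_npoly card_Fp.
Qed.

Lemma card_Vpart i : (i < 2 * b)%N -> #|Vpart p b i| = npart p b i.
Proof.
move=> ib.
(* Order exactly [i] means lying in the ideal of ['X^i] but not in the next one. *)
have -> : Vpart p b i = [set x : A | 'X^i %| (x : {poly 'F_p})]
                    :\: [set x : A | 'X^(i.+1) %| (x : {poly 'F_p})].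
  apply/setP => x; rewrite mem_Vpart // !inE.
  have [->|x0] := eqVneq x 0; first by rewrite dvdp0.
  by rewrite -!mup0_geq // -leqNgt eqn_leq.
rewrite cardsD (setIidPr _).
  rewrite (card_dvdp_Xn _ (ltnW ib)) (card_dvdp_Xn _ ib).
  by rewrite /npart -(subnSK ib) expnS mulnBl mul1n -subnDA add1n.
apply/subsetP => x; rewrite !inE; apply: dvdp_trans.
exact: dvdp_exp2l.
Qed.

(** * The zero-divisor graph: vertices, neighbours, degrees *)

Lemma mem_zdg_vertices x :
  (x \in zdg_vertices A) = (x != 0) && (0 < ord_truncated x)%N.
Proof.
rewrite inE; have [//|x0 /=] := eqVneq x 0.
apply/existsP/idP => [[y /andP[y0]]|x_gt0].
  (* A nonzero [y] has order below [2 * b], so it cannot annihilate an element of order 0. *)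
  rewrite truncated_mul_eq0_ord // => xy; rewrite lt0n; apply: contraTneq xy => ->.
  by rewrite -ltnNge ord_truncated_lt.
have Xlt : (2 * b - 1 < 2 * b)%N by rewrite subn1 prednK // muln_gt0.
(* The top power of the variable is nonzero and is killed by every multiple of it. *)
exists ('qX ^+ (2 * b - 1)); rewrite truncated_mul_eq0 truncated_eq0.
rewrite truncated_Xexp // -size_poly_eq0 size_polyXn /=.
rewrite -{1}(subnKC (_ : 1 <= 2 * b)%N) ?muln_gt0 // exprD dvdp_mul //.
by rewrite -mup0_geq.
Qed.

(** The ideal is the annihilator of [x]; 0 is not a vertex and [x] carries no loop. Its other
    elements are vertices because the exponent is positive. *)
Lemma neighboursE x : x \in zdg_vertices A ->
  neighbours (zdg_vertices A) (@zdg_adj A) x =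
  [set y : A | 'X^(2 * b - ord_truncated x) %| (y : {poly 'F_p})] :\ 0 :\ x.
Proof.
move=> xV; move: (xV); rewrite mem_zdg_vertices => /andP[x0 x_gt0].
apply/setP => y; rewrite inE mem_zdg_vertices /zdg_adj !inE eq_sym.
have [//|yx /=] := eqVneq y x; rewrite ?andbF //.
have [//|y0 /=] := eqVneq y 0.
rewrite truncated_mul_eq0_ord // -mup0_geq // leq_subLR andb_idl //.
rewrite -leq_subLR; apply: leq_trans.
by rewrite subn_gt0 ord_truncated_lt.
Qed.

(** The annihilator of [x] has [p ^ ord_truncated x] elements. Besides 0, [x] itself must be
    discarded exactly when its square is 0, that is when its order is at least [b]. *)
Lemma degreeE x : x \in zdg_vertices A ->
  degree (zdg_vertices A) (@zdg_adj A) x = dpart p b (ord_truncated x).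
Proof.
move=> xV; move: (xV); rewrite mem_zdg_vertices => /andP[x0 x_gt0].
rewrite /degree neighboursE // /dpart.
set W := [set y | _].
have W0 : 0 \in W by rewrite inE dvdp0.
have xW : (x \in W :\ 0) = (b <= ord_truncated x)%N.
  by rewrite !inE x0 -mup0_geq // leq_subLR addnn -mul2n leq_pmul2l.
have := card_dvdp_Xn _ (leq_subr (ord_truncated x) _).
rewrite subKn => [cardW|]; last exact: ltnW (ord_truncated_lt _ x0).
rewrite -cardW (cardsD1 0 W) W0 (cardsD1 x (W :\ 0)) xW.
by case: leqP => _; rewrite ?add0n ?add1n ?subSS ?subn0 // subn0.
Qed.

(** Only orders decide whether a product vanishes, so [x] annihilates all of [Vpart p b j] or none
    of it; the missing loop costs 1 if [x] lies in that class. *)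
Lemma card_neighbours_Vpart j x : (j < 2 * b)%N -> x \in zdg_vertices A ->
  #|neighbours (zdg_vertices A) (@zdg_adj A) x :&: Vpart p b j| =
  Qentry p b (ord_truncated x) j.
Proof.
move=> jb xV; move: (xV); rewrite mem_zdg_vertices => /andP[x0 x_gt0].
rewrite neighboursE // /Qentry.
have [oxj|oxj] := leqP (2 * b) (ord_truncated x + j).
  rewrite (_ : _ :&: _ = Vpart p b j :\ x); last first.
    apply/setP => y; rewrite !inE mem_Vpart //; have [//|_ /=] := eqVneq y x.
    have [//|y0 /=] := eqVneq y 0.
    by rewrite andb_idl // => /eqP yj; rewrite -mup0_geq // leq_subLR -yj in oxj *.
  have := card_Vpart _ jb; rewrite (cardsD1 x) mem_Vpart // x0 /=.
  have [xj|_ <- //] := eqVneq (ord_truncated x) j.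
  rewrite -xj addnn -mul2n leq_pmul2l // in oxj * => <-.
  by rewrite ltnNge oxj add1n subn1.
rewrite (_ : _ :&: _ = set0) ?cards0.
  have [xj|//] := eqVneq (ord_truncated x) j.
  by rewrite -xj addnn -mul2n ltn_pmul2l // in oxj *; rewrite oxj.
apply/setP => y; rewrite !inE mem_Vpart //; apply/negP.
move=> /andP[/and3P[_ y0]] + /andP[_ /eqP yj].
by rewrite -mup0_geq // leq_subLR -/(ord_truncated y) yj leqNgt oxj.
Qed.

End TruncatedPolynomials.

(** * The characteristic polynomial of the weighted matrix *)

Section Spectrum.

Variables (R : rcfType) (p b : nat) (alpha : R).
Hypotheses (p_prime : prime p) (b_gt0 : (0 < b)%N).

Local Notation A := (truncated_poly_ring p b).
Local Notation V := (zdg_vertices A).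
Local Notation adj := (@zdg_adj A).

(** The block constant also fills the diagonal, where the adjacency matrix is 0; [lambda] absorbs
    the difference. *)
Lemma lambda_dpart (o : nat) : (0 < o)%N ->
  alpha * (dpart p b o)%:R =
  lambda p b alpha o + (if (2 * b <= o + o)%N then 1 - alpha else 0).
Proof.
move=> o_gt0; rewrite /dpart /lambda addnn -mul2n leq_pmul2l //.
have po : (1 < p ^ o)%N by rewrite -(exp1n o) ltn_exp2r // prime_gt1.
have po' := ltnW po.
by case: (ltnP o b) => _ /=; rewrite natrB ?natrX //; ring.
Qed.

Lemma Qentry_npart (i j : nat) :
  (Qentry p b i j)%:R = (if (2 * b <= i + j)%N then (npart p b j)%:R else 0)
    - ((i == j) && (2 * b <= i + i)%N)%:R :> R.
Proof.
rewrite /Qentry; have [<-|_] /= := eqVneq i j; last first.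
  by case: ifP; rewrite subr0.
rewrite addnn -mul2n leq_pmul2l //.
case: (ltnP i b) => _ /=; rewrite ?subr0 // natrB //.
by rewrite muln_gt0 subn_gt0 prime_gt1 //= expn_gt0 prime_gt0.
Qed.

Lemma char_poly_Aalpha_mx :
  char_poly (Aalpha_mx V adj alpha) =
  \prod_(k < 2 * b - 1)
    ('X - (lambda p b alpha k.+1)%:P) ^+ (npart p b k.+1 - 1) *
  char_poly (Bmx p b alpha).
Proof.
have B_gt0 : (0 < 2 * b - 1)%N.
  by rewrite subn_gt0 (leq_trans (_ : 1 < 2 * 1)%N) // leq_mul2l.
pose x (i : 'I_#|V|) : A := enum_val i.
have x_vertex i : x i \in V by apply: enum_valP.
have x_neq0 i : x i != 0.
  by have := x_vertex i; rewrite mem_zdg_vertices // => /andP[].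
have x_gt0 i : (0 < ord_truncated p b (x i))%N.
  by have := x_vertex i; rewrite mem_zdg_vertices // => /andP[].
(* Indices are orders shifted down by one. The default of [insubd] is never reached, since vertices
   have order between 1 and [2 * b - 1]. *)
pose c i : 'I_(2 * b - 1) := insubd (Ordinal B_gt0) (ord_truncated p b (x i)).-1.
have cE i : (c i).+1 = ord_truncated p b (x i).
  rewrite val_insubd -ltnS prednK // -subSn ?muln_gt0 // subn1 /=.
  by rewrite ord_truncated_lt // prednK.
have lt2b (k : 'I_(2 * b - 1)) : (k.+1 < 2 * b)%N.
  by have := ltn_ord k; rewrite ltn_subRL add1n.
pose q (k k' : 'I_(2 * b - 1)) : R :=
  if (2 * b <= k.+1 + k'.+1)%N then 1 - alpha else 0.
have AE : Aalpha_mx V adj alpha = \matrix_(i, j)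
    (lambda p b alpha (c i).+1 *+ (i == j) + q (c i) (c j)).
  apply/matrixP => i j; rewrite !mxE /q !cE.
  have [<-|ij] := eqVneq i j; rewrite ?mulr1n ?mulr0n ?mulr0 ?add0r.
    rewrite /zdg_adj eqxx mulr0 addr0 -lambda_dpart //.
    by rewrite degreeE.
  rewrite /zdg_adj (inj_eq enum_val_inj) ij -/(x i) -/(x j).
  by rewrite truncated_mul_eq0_ord //; case: ifP; rewrite ?mulr1 ?mulr0.
(* On the diagonal, for orders at least [b], the extra [1 - alpha] from [lambda_dpart] cancels the
   [-1] in [Qentry], weighted by [1 - alpha]. *)
have BE : Bmx p b alpha = \matrix_(k, k')
    (lambda p b alpha k.+1 *+ (k == k') + q k k' * (npart p b k'.+1)%:R).
  apply/matrixP => k k'; rewrite !mxE /q.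
  rewrite [alpha * _]mulrnAr lambda_dpart // Qentry_npart // eqSS (inj_eq val_inj).
  move: (npart _ _ _)%:R (lambda _ _ _ _) => N L.
  have [<-|_] := eqVneq k k'; last first.
    by rewrite !mulr0n; case: ifP => _ /=; ring.
  by case: ifP => _ /=; ring.
have cardE k : #|[set i | c i == k]| = npart p b k.+1.
  rewrite -card_Vpart // -(card_imset _ enum_val_inj); congr #|pred_of_set _|.
  apply/setP => y; rewrite mem_Vpart //; apply/imsetP/andP => [[j] | [y0 /eqP yk]].
    by rewrite inE => /eqP <- ->; rewrite -/(x j) cE.
  have yV : y \in V by rewrite mem_zdg_vertices // y0 yk.
  exists (enum_rank_in yV y); last by rewrite enum_rankK_in.
  rewrite inE -val_eqE -eqSS cE /x enum_rankK_in //; exact/eqP.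
rewrite AE BE; apply: char_poly_equitable => // k.
by rewrite muln_gt0 subn_gt0 prime_gt1 //= expn_gt0 prime_gt0.
Qed.

End Spectrum.

(** * From the characteristic polynomial to the multiset of eigenvalues *)

Lemma prod_XsubC_nseq (K : nzRingType) (n : nat) (a : K) :
  \prod_(z <- nseq n a) ('X - z%:P) = ('X - a%:P) ^+ n.
Proof. by rewrite big_nseq iter_mulr_1. Qed.

Theorem theorem2p2 (R : rcfType) (p b : nat) (alpha : R)
    (p_prime : prime p) (b_ge1 : (1 <= b)%N) (alpha01 : 0 <= alpha <= 1) :
  let V := zdg_vertices (truncated_poly_ring p b) in
  let adj := @zdg_adj (truncated_poly_ring p b) in
  [/\ (* the V_i partition the vertex set *)
      V = \bigcup_(1 <= i < 2 * b) Vpart p b i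
      /\ (forall i j, (1 <= i < 2 * b)%N -> (1 <= j < 2 * b)%N -> i != j ->
            [disjoint Vpart p b i & Vpart p b j]),
      (forall i, (1 <= i < 2 * b)%N -> #|Vpart p b i| = npart p b i),
      (forall i x, (1 <= i < 2 * b)%N -> x \in Vpart p b i ->
         degree V adj x = dpart p b i),
      (* Q^* is the quotient matrix *)
      (forall i j x, (1 <= i < 2 * b)%N -> (1 <= j < 2 * b)%N ->
         x \in Vpart p b i ->
         #|neighbours V adj x :&: Vpart p b j| = Qentry p b i j)
    & perm_eq (spectrum (Aalpha_mx V adj alpha))
        (flatten [seq nseq (npart p b i - 1) (lambda p b alpha i)%:C
                   | i <- iota 1 (2 * b - 1)]
         ++ spectrum (Bmx p b alpha))].
Proof.
move=> V adj.
have in_V i x : (1 <= i < 2 * b)%N -> x \in Vpart p b i ->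
    x \in V /\ ord_truncated p b x = i.
  move=> /andP[i_gt0 ib]; rewrite mem_Vpart // => /andP[x0 /eqP xi].
  by rewrite mem_zdg_vertices // x0 xi.
split.
- split=> [|i j ib jb ij].
    apply/setP => x; rewrite big_geq_mkord; apply/idP/bigcupP => [|[k]].
      rewrite mem_zdg_vertices // => /andP[x0 x_gt0].
      have xb := ord_truncated_lt p b b_ge1 x x0.
      by exists (Ordinal xb); rewrite ?mem_Vpart ?x0 /=.
    by move=> k_gt0 /in_V[] //; apply/andP; split=> //; apply: ltn_ord.
  rewrite -setI_eq0; apply: contraNT ij => /set0Pn[x /setIP[xi xj]].
  have [_ <-] := in_V i x ib xi.
  by have [_ <-] := in_V j x jb xj.
- by move=> i /andP[_ ib]; apply: card_Vpart.
- by move=> i x ib /(in_V i x ib)[xV <-]; apply: degreeE.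
- move=> i j x ib /andP[_ jb] /(in_V i x ib)[xV <-].
  exact: card_neighbours_Vpart.
(* Two lists are permutations of each other once their products of monic linear factors agree. *)
apply: prod_XsubC_eq; rewrite -spectrumP big_cat -spectrumP /=.
rewrite -!map_char_poly char_poly_Aalpha_mx // rmorphM; congr (_ * _).
(* The list starting at 1 becomes an [index_iota], so that its indices can be shifted to the
   ordinals [k] with [k.+1] as class number. *)
rewrite big_flatten big_map -[X in iota 1 X](subn1 (2 * b - 1).+1) -/(index_iota _ _).
rewrite rmorph_prod big_add1 big_mkord; apply: eq_bigr => k _ /=.
by rewrite prod_XsubC_nseq rmorphXn rmorphB /= map_polyX map_polyC.
Qed.
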